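(* Let $K$ be a field. Any interchangeable structure on $UT_3(K)$ is isomorphic to exactly one of the following structures (where $\alpha,\beta,\gamma$ are parameters in $K$, and products of basis elements that are not listed are zero): (1) $e_{12}\star e_{12}=\alpha e_{13}$, $e_{12}\star e_{23}=\beta e_{13}$, $e_{23}\star e_{12}=\gamma e_{13}$, $e_{23}\star e_{23}=e_{13}$; (2) $e_{12}\star e_{12}=e_{13}$, $e_{12}\star e_{23}=\alpha e_{13}$, $e_{23}\star e_{12}=\beta e_{13}$; (3) $e_{12}\star e_{23}=\alpha e_{13}$, $e_{23}\star e_{12}=\beta e_{13}$. In particular, any interchangeable structure on $UT_3(K)$ is totally compatible with the matrix product $\cdot$.
   Context: $K$ is an arbitrary field; all products are $K$-bilinear. $UT_3(K)$ is the associative algebra of strictly upper triangular $3\times 3$ matrices over $K$ with the usual matrix product $\cdot$; it has $K$-basis $e_{12},e_{23},e_{13}$ of matrix units, and the only nonzero product of basis elements is $e_{12}\cdot e_{23}=e_{13}$. An interchangeable structure on an associative algebra $(A,\cdot)$ is an associative bilinear product $*$ on $A$ such that $(a\cdot b)*c=(a*b)\cdot c$ and $a\cdot(b*c)=a*(b\cdot c)$ for all $a,b,c\in A$. An associative product $*$ on $A$ is totally compatible with $\cdot$ if $(a\cdot b)*c=(a*b)\cdot c=a\cdot(b*c)=a*(b\cdot c)$ for all $a,b,c\in A$. Two structures $*_1$ and $*_2$ on $(A,\cdot)$ are isomorphic if there is an algebra automorphism $\phi$ of $(A,\cdot)$ with $\phi(a*_1b)=\phi(a)*_2\phi(b)$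 for all $a,b\in A$. In the families, different values of the parameters count as different structures. *)

(* Defs.v *)
From HB Require Import structures.
From mathcomp Require Import all_boot all_order all_algebra.

Set Implicit Arguments.
Unset Strict Implicit.
Unset Printing Implicit Defensive.

Import GRing.Theory.
Local Open Scope ring_scope.

(* MathComp has no non-unital algebras: an associative algebra (A, dot) is a
   left module A over K together with an associative bilinear product dot. *)
Section Structures.
Variables (K : fieldType) (A : lmodType K).
Implicit Types dot star : {bilinear A -> A -> A}.

Definition interchangeable_structure dot star : Prop :=
  [/\ associative star,
      forall a b c : A, star (dot a b) c = dot (star a b) c
    & forall a b c : A, dot a (star b c) = star a (dot b c)].

Definition totally_compatible dot star : Prop :=
  associative star /\
  forall a b c : A,
    [/\ star (dot a b) c = dot (star a b) c,
        dot (star a b) c = dot a (star b c)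
      & dot a (star b c) = star a (dot b c)].

Definition algebra_automorphism dot (phi : {linear A -> A}) : Prop :=
  bijective phi /\ forall a b : A, phi (dot a b) = dot (phi a) (phi b).

Definition isomorphic_structures dot star1 star2 : Prop :=
  exists phi : {linear A -> A},
    algebra_automorphism dot phi /\
    forall a b : A, phi (star1 a b) = star2 (phi a) (phi b).

End Structures.

Section StrictlyUpperTriangular.
Variables (K : fieldType) (n : nat).

Definition strictly_upper : {pred 'M[K]_n} :=
  fun M => [forall i : 'I_n, forall j : 'I_n, (j <= i)%N ==> (M i j == 0)].

Lemma strictly_upperP (M : 'M[K]_n) :
  reflect (forall i j : 'I_n, (j <= i)%N -> M i j = 0) (M \in strictly_upper).
Proof.
apply: (iffP forallP) => [H i j ji | H i].
  by move/forallP/(_ j)/implyP/(_ ji)/eqP: (H i).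
by apply/forallP => j; apply/implyP => ji; rewrite H.
Qed.

Lemma strictly_upper_submod_closed : submod_closed strictly_upper.
Proof.
split; first by apply/strictly_upperP => i j _; rewrite mxE.
move=> a M N /strictly_upperP HM /strictly_upperP HN.
by apply/strictly_upperP => i j ji; rewrite !mxE HM // HN // mulr0 addr0.
Qed.

HB.instance Definition _ :=
  GRing.isSubmodClosed.Build K 'M[K]_n strictly_upper
    strictly_upper_submod_closed.

Record UT := MkUT { UT_val :> 'M[K]_n; UT_valP : UT_val \in strictly_upper }.

HB.instance Definition _ := [isSub for UT_val].
HB.instance Definition _ := [Choice of UT by <:].
HB.instance Definition _ := [SubChoice_isSubLmodule of UT by <:].

Lemma strictly_upper_mulmx (x y : UT) :
  UT_val x *m UT_val y \in strictly_upper.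
Proof.
have /strictly_upperP Hx := UT_valP x; have /strictly_upperP Hy := UT_valP y.
apply/strictly_upperP => i j ji; rewrite mxE big1 // => k _.
case: (leqP k i) => ki; first by rewrite Hx // mul0r.
by rewrite Hy ?mulr0 // (leq_trans ji) // ltnW.
Qed.

Definition UT_mul (x y : UT) : UT := MkUT (strictly_upper_mulmx x y).

Lemma UT_mul_is_bilinear : bilinear_for
  (GRing.Scale.Law.clone _ _ *:%R _) (GRing.Scale.Law.clone _ _ *:%R _) UT_mul.
Proof.
split=> [y | x] a u v; apply: val_inj => /=.
  by rewrite mulmxDl -scalemxAl.
by rewrite mulmxDr -scalemxAr.
Qed.

HB.instance Definition _ :=
  bilinear_isBilinear.Build K UT UT UT _ _ UT_mul UT_mul_is_bilinear.

Lemma UT_mulA : associative UT_mul.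
Proof. by move=> x y z; apply: val_inj; rewrite /= mulmxA. Qed.

Lemma strictly_upper_delta (i j : 'I_n) (ij : (i < j)%N) :
  delta_mx i j \in strictly_upper.
Proof.
apply/strictly_upperP => k l lk; rewrite mxE.
by case: eqP => // ki; case: eqP => // lj; rewrite ki lj leqNgt ij in lk.
Qed.

Definition UT_unit (i j : 'I_n) (ij : (i < j)%N) : UT :=
  MkUT (strictly_upper_delta ij).

End StrictlyUpperTriangular.

Section UT3.
Variable K : fieldType.

(* Rows and columns are numbered 0, 1, 2 in 'I_3. *)
Definition e12 : UT K 3 := @UT_unit K 3 0 1 isT.
Definition e23 : UT K 3 := @UT_unit K 3 1 2 isT.
Definition e13 : UT K 3 := @UT_unit K 3 0 2 isT.

(* The bilinear extension of the multiplication table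
   e12 * e12 = p e13, e12 * e23 = q e13, e23 * e12 = r e13, e23 * e23 = s e13,
   all other products of basis elements being 0 (see e13_mul_table). *)
Definition e13_mul (p q r s : K) (x y : UT K 3) : UT K 3 :=
  (x 0 1 * y 0 1 * p + x 0 1 * y 1 2 * q
   + x 1 2 * y 0 1 * r + x 1 2 * y 1 2 * s) *: e13.

Lemma e13_mul_is_bilinear p q r s : bilinear_for
  (GRing.Scale.Law.clone _ _ *:%R _) (GRing.Scale.Law.clone _ _ *:%R _)
  (e13_mul p q r s).
Proof.
split=> [y | x] a u v; rewrite /e13_mul /= scalerA -scalerDl; congr (_ *: _);
  rewrite !mxE.
  by rewrite !mulrDl !mulrDr !mulrA [RHS]addrACA; congr (_ + _);
     rewrite [RHS]addrACA; congr (_ + _); rewrite [RHS]addrACA.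
have E c d e : c * (a * d) * e = a * (c * d * e) by rewrite !mulrA [c * a]mulrC.
rewrite !mulrDr !mulrDl !E.
by rewrite [RHS]addrACA; congr (_ + _);
   rewrite [RHS]addrACA; congr (_ + _); rewrite [RHS]addrACA.
Qed.

HB.instance Definition _ p q r s :=
  bilinear_isBilinear.Build K (UT K 3) (UT K 3) (UT K 3) _ _
    (e13_mul p q r s) (e13_mul_is_bilinear p q r s).

Lemma e13_mul_table p q r s (star := e13_mul p q r s) :
  [/\ star e12 e12 = p *: e13, star e12 e23 = q *: e13,
      star e23 e12 = r *: e13 & star e23 e23 = s *: e13]
  /\ forall x, star e13 x = 0 /\ star x e13 = 0.
Proof.
rewrite /star /e13_mul; split.
  by split; congr (_ *: _);
     rewrite !mxE /= ?(mul1r, mul0r, mulr0, addr0, add0r).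
by move=> x; split; rewrite !mxE /= ?(mul0r, mulr0, addr0) scale0r.
Qed.

Lemma UT3_basis (x : UT K 3) : x = x 0 1 *: e12 + x 1 2 *: e23 + x 0 2 *: e13.
Proof.
apply: val_inj; apply/matrixP => i j; have /strictly_upperP Hx := UT_valP x.
rewrite /= !mxE.
case: i j => [[|[|[|//]]] ?] [[|[|[|//]]] ?] /=;
  rewrite ?mulr1 ?mulr0 ?addr0 ?add0r; first [by apply: Hx |
  by congr (UT_val x _ _); apply: val_inj].
Qed.

(* Family and parameters of a listed structure; distinct parameter values
   give distinct indices. *)
Variant canonical_index :=
  | Family1 of K & K & K
  | Family2 of K & K
  | Family3 of K & K.

Definition canonical_structure (c : canonical_index) :
    {bilinear UT K 3 -> UT K 3 -> UT K 3} :=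
  match c with
  | Family1 alpha beta gamma => e13_mul alpha beta gamma 1
  | Family2 alpha beta => e13_mul 1 alpha beta 0
  | Family3 alpha beta => e13_mul 0 alpha beta 0
  end.

End UT3.

(* Main.v *)
Require Import Defs.
From HB Require Import structures.
From mathcomp Require Import all_boot all_order all_algebra.
From mathcomp Require Import ring.
Import GRing.Theory.
Local Open Scope ring_scope.

(** Write l and m for the e12- and e23-coordinates, so that the matrix product
    is x . y = l(x) m(y) e13.

    Let * be interchangeable.  Multiplying x * y by e23 on the right reads off
    l(x * y), and interchangeability turns this product into
    (x . y) * e23 = l(x) m(y) (e13 * e23).  Hence
    l(x * y) = l0 l(x) m(y) with l0 = l(e12 * e23), and dually
    m(x * y) = m0 l(x) m(y) with m0 = m(e12 * e23).  Associativity of * then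
    gives l0^2 = m0^2 = 0, so every product x * y lies in K e13
    ([interchangeable_coords0]).  It follows that e13 is annihilated by *, so
    * is one of the products [e13_mul p q r s], and both sides of each
    compatibility condition vanish identically, which is total compatibility.

    It remains to classify the tables (p, q, r, s).  The square-zero relations
    e12 . e12 = e23 . e23 = 0 force an automorphism to act on (l, m) diagonally,
    by nonzero scalars (a, d), and it multiplies e13 by a d
    ([automorphism_coords]).  So it fixes q and r and sends p to p t and s to
    s / t, where t = d / a ([isomorphic_e13_mulP]).  If s <> 0, there is a
    unique t making s equal to 1, and p becomes p s; if s = 0 <> p, there is a
    unique t making p equal to 1; if p = s = 0, nothing changes.  These are the
    three families ([isomorphic_canonicalP]). *)

Section Interchangeable.
Variable K : fieldType.
Implicit Types (x y z : UT K 3) (p q r s d t : K).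

(** * Coordinates *)

Lemma UT3_ext x y :
  x 0 1 = y 0 1 -> x 1 2 = y 1 2 -> x 0 2 = y 0 2 -> x = y.
Proof. by move=> E1 E2 E3; rewrite (UT3_basis x) (UT3_basis y) E1 E2 E3. Qed.

Lemma UT_mulE x y : UT_mul x y = (x 0 1 * y 1 2) *: e13 K.
Proof.
have /strictly_upperP Hx := UT_valP x; have /strictly_upperP Hy := UT_valP y.
have sum3 (F : 'I_3 -> K) : \sum_k F k = F 0 + F 1 + F 2.
  rewrite !big_ord_recl big_ord0 addr0 addrA.
  by congr (F _ + F _ + F _); apply: val_inj.
apply: UT3_ext; rewrite !mxE sum3 /= ?mulr1 ?mulr0.
- by rewrite (Hx 0 0) // (Hy 1 1) // (Hy 2 1) // mul0r !mulr0 !addr0.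
- by rewrite (Hx 1 0) // (Hx 1 1) // (Hy 2 2) // !mul0r mulr0 !addr0.
by rewrite (Hx 0 0) // (Hy 2 2) // mul0r mulr0 addr0 add0r.
Qed.

Lemma e13_scale_inj s t : s *: e13 K = t *: e13 K -> s = t.
Proof.
by move=> /(congr1 (fun x : UT K 3 => x 0 2)); rewrite !mxE /= !mulr1.
Qed.

Lemma e12_coords : [/\ e12 K 0 1 = 1, e12 K 1 2 = 0 & e12 K 0 2 = 0].
Proof. by split; rewrite !mxE. Qed.

Lemma e23_coords : [/\ e23 K 0 1 = 0, e23 K 1 2 = 1 & e23 K 0 2 = 0].
Proof. by split; rewrite !mxE. Qed.

Lemma e13_neq0 : e13 K != 0.
Proof.
apply/eqP => /(congr1 (fun x : UT K 3 => x 0 2)); rewrite !mxE /=.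
by apply/eqP; rewrite oner_neq0.
Qed.

Lemma UT_mul_basis : UT_mul (e12 K) (e23 K) = e13 K.
Proof. by rewrite UT_mulE !mxE mulr1 scale1r. Qed.

(** * Products with values in the line of e13 *)

(** Both products take values in the line K e13 and vanish as soon as one
    factor is on that line. *)
Lemma e13_mul_triple0 p q r s x y z (star := e13_mul p q r s) :
  [/\ star (star x y) z = 0, star x (star y z) = 0,
      star (UT_mul x y) z = 0 & star x (UT_mul y z) = 0]
  /\ UT_mul (star x y) z = 0 /\ UT_mul x (star y z) = 0.
Proof.
by rewrite /star !UT_mulE /e13_mul !mxE /= !(mulr0, mul0r, addr0, scale0r).
Qed.

Lemma e13_mul_interchangeable p q r s :
  interchangeable_structure (@UT_mul K 3) (e13_mul p q r s).
Proof.
split=> x y z; have [[E1 E2 E3 E4] [E5 E6]] := e13_mul_triple0 p q r s x y z.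
- exact: etrans E2 (esym E1).
- exact: etrans E3 (esym E5).
exact: etrans E6 (esym E4).
Qed.

Section Structure.
Variable star : {bilinear UT K 3 -> UT K 3 -> UT K 3}.
Hypothesis star_interch : interchangeable_structure (@UT_mul K 3) star.

Lemma star_mull x y z : star (UT_mul x y) z = UT_mul (star x y) z.
Proof. by case: star_interch => _ H _; apply: H. Qed.

Lemma star_mulr x y z : UT_mul x (star y z) = star x (UT_mul y z).
Proof. by case: star_interch => _ _ H; apply: H. Qed.

Let l0 := star (e12 K) (e23 K) 0 1.
Let m0 := star (e12 K) (e23 K) 1 2.

(** Apply interchangeability to (x * y) . e23 and e12 . (x * y): right
    multiplication by e23 detects the e12-coordinate, left multiplication by
    e12 detects the e23-coordinate. *)
Lemma interchangeable_coords x y :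
  star x y 0 1 = l0 * (x 0 1 * y 1 2) /\ star x y 1 2 = m0 * (x 0 1 * y 1 2).
Proof.
have [e12_1 e12_2 _] := e12_coords; have [e23_1 e23_2 _] := e23_coords.
have e13l z : star (e13 K) z = (l0 * z 1 2) *: e13 K.
  by rewrite -{1}UT_mul_basis star_mull UT_mulE.
have e13r z : star z (e13 K) = (z 0 1 * m0) *: e13 K.
  by rewrite -{1}UT_mul_basis -star_mulr UT_mulE.
split; apply: e13_scale_inj.
  transitivity (UT_mul (star x y) (e23 K)).
    by rewrite UT_mulE e23_2 mulr1.
  by rewrite -star_mull UT_mulE linearZl_LR e13l e23_2 mulr1 scalerA mulrC.
transitivity (UT_mul (e12 K) (star x y)).
  by rewrite UT_mulE e12_1 mul1r.
by rewrite star_mulr UT_mulE linearZr_LR e13r e12_1 mul1r scalerA mulrC.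
Qed.

(** Associativity at (e12, e23, e23) in the first coordinate gives l0^2 = 0,
    and at (e12, e12, e23) in the second one m0^2 = 0. *)
Lemma interchangeable_coords0 x y : star x y 0 1 = 0 /\ star x y 1 2 = 0.
Proof.
have [H0 _ _] := star_interch.
have [e12_1 e12_2 _] := e12_coords; have [e23_1 e23_2 _] := e23_coords.
have L u v : star u v 0 1 = l0 * (u 0 1 * v 1 2).
  by case: (interchangeable_coords u v).
have M u v : star u v 1 2 = m0 * (u 0 1 * v 1 2).
  by case: (interchangeable_coords u v).
have l00 : l0 = 0.
  have := congr1 (fun z : UT K 3 => z 0 1) (H0 (e12 K) (e23 K) (e23 K)).
  rewrite /= !L M e12_1 e23_1 e23_2 !(mul0r, mulr0, mul1r, mulr1).
  by move=> /esym/eqP; rewrite mulf_eq0 orbb => /eqP.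
have m00 : m0 = 0.
  have := congr1 (fun z : UT K 3 => z 1 2) (H0 (e12 K) (e12 K) (e23 K)).
  rewrite /= !M L e12_1 e12_2 e23_2 !(mul0r, mulr0, mul1r, mulr1).
  by move=> /eqP; rewrite mulf_eq0 orbb => /eqP.
by rewrite L M l00 m00 !mul0r.
Qed.

Lemma interchangeable_e13_mul :
  exists p q r s, forall x y, star x y = e13_mul p q r s x y.
Proof.
have star13 x y : star x y = star x y 0 2 *: e13 K.
  have [E1 E2] := interchangeable_coords0 x y.
  by rewrite {1}(UT3_basis (star x y)) E1 E2 !scale0r !add0r.
have e13l z : star (e13 K) z = 0.
  have [E _] := interchangeable_coords0 (e12 K) (e23 K).
  by rewrite -UT_mul_basis star_mull UT_mulE E mul0r scale0r.
have e13r z : star z (e13 K) = 0.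
  have [_ E] := interchangeable_coords0 (e12 K) (e23 K).
  by rewrite -UT_mul_basis -star_mulr UT_mulE E mulr0 scale0r.
exists (star (e12 K) (e12 K) 0 2), (star (e12 K) (e23 K) 0 2),
  (star (e23 K) (e12 K) 0 2), (star (e23 K) (e23 K) 0 2) => x y.
rewrite {1}(UT3_basis x) {1}(UT3_basis y).
rewrite !(linearDl, linearDr, linearZl_LR, linearZr_LR) /=.
rewrite !(e13l, e13r, scaler0, addr0).
rewrite (star13 (e12 K) (e12 K)) (star13 (e12 K) (e23 K)).
rewrite (star13 (e23 K) (e12 K)) (star13 (e23 K) (e23 K)).
rewrite !scalerA -!scalerDl !mxE /=.
by congr (_ *: _); ring.
Qed.

End Structure.

(** * Automorphisms *)

(** With a, b (resp. c, d) the coordinates of phi e12 (resp. phi e23) on e12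
    and e23, the image of e13 = e12 . e23 is a d e13, so a and d are nonzero;
    the relations e12 . e12 = 0 = e23 . e23 read a b = 0 = c d. *)
Lemma automorphism_coords (phi : {linear UT K 3 -> UT K 3}) :
    algebra_automorphism (@UT_mul K 3) phi ->
  exists a d, [/\ a != 0, d != 0, phi (e13 K) = (a * d) *: e13 K
    & forall x, phi x 0 1 = a * x 0 1 /\ phi x 1 2 = d * x 1 2].
Proof.
move=> [phi_bij phi_mul].
have phiM x y : phi (UT_mul x y) = UT_mul (phi x) (phi y) by apply: phi_mul.
have phi_inj := bij_inj phi_bij.
have [e12_1 e12_2 _] := e12_coords; have [e23_1 e23_2 _] := e23_coords.
set a := phi (e12 K) 0 1; set d := phi (e23 K) 1 2.
have phi13 : phi (e13 K) = (a * d) *: e13 K.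
  by rewrite -UT_mul_basis phiM UT_mulE UT_mul_basis.
have : a * d != 0.
  apply/eqP => ad0; move: phi13; rewrite ad0 scale0r -(linear0 phi).
  by move/phi_inj/eqP; rewrite (negPf e13_neq0).
rewrite mulf_eq0 negb_or => /andP[a0 d0].
have b0 : phi (e12 K) 1 2 = 0.
  have := phiM (e12 K) (e12 K).
  rewrite !UT_mulE e12_2 mulr0 linearZ /= scale0r -(scale0r (e13 K)).
  move=> /e13_scale_inj/esym/eqP.
  by rewrite mulf_eq0 (negPf a0) => /eqP.
have c0 : phi (e23 K) 0 1 = 0.
  have := phiM (e23 K) (e23 K).
  rewrite !UT_mulE e23_1 mul0r linearZ /= scale0r -(scale0r (e13 K)).
  move=> /e13_scale_inj/esym/eqP.
  by rewrite mulf_eq0 (negPf d0) orbF => /eqP.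
exists a, d; split=> // x.
rewrite {1 3}(UT3_basis x) !linearD !linearZ /= phi13 !mxE /= -/a -/d b0 c0.
by split; ring.
Qed.

(** For t <> 0, this is conjugation by the diagonal matrix diag(1, 1, t). *)
Definition rescale t x : UT K 3 :=
  x 0 1 *: e12 K + (t * x 1 2) *: e23 K + (t * x 0 2) *: e13 K.

Lemma rescale_is_linear t : linear (rescale t).
Proof. by move=> k x y; apply: UT3_ext; rewrite !mxE /=; ring. Qed.

HB.instance Definition _ t :=
  GRing.isLinear.Build K (UT K 3) (UT K 3) _ (rescale t) (rescale_is_linear t).

Lemma rescale_coords t x :
  [/\ rescale t x 0 1 = x 0 1, rescale t x 1 2 = t * x 1 2
    & rescale t x 0 2 = t * x 0 2].
Proof. by split; rewrite !mxE /=; ring. Qed.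

Lemma rescale_e13 t : rescale t (e13 K) = t *: e13 K.
Proof. by apply: UT3_ext; rewrite !mxE /=; ring. Qed.

Lemma rescaleK s t : s * t = 1 -> cancel (rescale t) (rescale s).
Proof.
move=> st x.
have [E1 E2 E3] := rescale_coords t x.
have [F1 F2 F3] := rescale_coords s (rescale t x).
by apply: UT3_ext; rewrite ?F1 ?F2 ?F3 ?E1 ?E2 ?E3 // mulrA st mul1r.
Qed.

Lemma rescale_automorphism t :
  t != 0 -> algebra_automorphism (@UT_mul K 3) (rescale t).
Proof.
move=> t0; split.
  by exists (rescale t^-1); apply: rescaleK; rewrite ?mulVf ?mulfV.
move=> x y.
change (rescale t (UT_mul x y) = UT_mul (rescale t x) (rescale t y)).
have [E1 _ _] := rescale_coords t x; have [_ F2 _] := rescale_coords t y.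
by rewrite !UT_mulE linearZ /= rescale_e13 scalerA E1 F2; congr (_ *: _); ring.
Qed.

(** * Classification *)

(** For an automorphism scaling e12, e23 by a, d modulo e13, the scalar t is
    d / a.  Only this ratio matters, so if two such products are isomorphic,
    then some [rescale t] is an isomorphism between them. *)
Lemma isomorphic_e13_mulP p q r s p' q' r' s' :
  isomorphic_structures (@UT_mul K 3) (e13_mul p q r s) (e13_mul p' q' r' s')
  <-> [/\ q' = q, r' = r & exists2 t, t != 0 & p' = p * t /\ s = s' * t].
Proof.
split=> [[phi [phi_aut iso]] | [-> -> [t t0 [-> ->]]]]; last first.
  exists (rescale t); split; first exact: rescale_automorphism.
  move=> x y; have [E1 E2 _] := rescale_coords t x.
  have [F1 F2 _] := rescale_coords t y.
  rewrite /= /e13_mul linearZ /= rescale_e13 scalerA E1 E2 F1 F2.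
  by congr (_ *: _); ring.
have phi_iso x y :
  phi (e13_mul p q r s x y) = e13_mul p' q' r' s' (phi x) (phi y) by apply: iso.
have [a [d [a0 d0 phi13 phiE]]] := automorphism_coords _ phi_aut.
have ad0 : a * d != 0 by rewrite mulf_neq0.
have [e12_1 e12_2 _] := e12_coords; have [e23_1 e23_2 _] := e23_coords.
have [A1 A2] := phiE (e12 K); have [D1 D2] := phiE (e23 K).
rewrite e12_1 e12_2 mulr1 mulr0 in A1 A2.
rewrite e23_1 e23_2 mulr1 mulr0 in D1 D2.
have [[T1 T2 T3 T4] _] := e13_mul_table p q r s.
have Ep := phi_iso (e12 K) (e12 K); have Eq := phi_iso (e12 K) (e23 K).
have Er := phi_iso (e23 K) (e12 K); have Es := phi_iso (e23 K) (e23 K).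
move: Ep Eq Er Es; rewrite T1 T2 T3 T4 !linearZ /= phi13 !scalerA.
rewrite /e13_mul !A1 !A2 !D1 !D2 !(mul0r, mulr0, add0r, addr0).
move=> /e13_scale_inj Ep /e13_scale_inj Eq.
move=> /e13_scale_inj Er /e13_scale_inj Es.
split.
- by apply: (mulfI ad0); rewrite -Eq mulrC.
- by apply: (mulfI ad0); rewrite [a * d]mulrC -Er; ring.
exists (d / a); first by rewrite mulf_neq0 ?invr_neq0.
split.
  apply: (mulfI (mulf_neq0 a0 a0)); rewrite -Ep.
  by field.
apply: (mulIf ad0); rewrite Es.
by field.
Qed.

(** The value p * s in the first branch is the effect of t = s on p, the ratio
    that brings s to 1. *)
Definition normal_index p q r s : canonical_index K :=
  if s != 0 then Family1 (p * s) q r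
  else if p != 0 then Family2 q r else Family3 q r.

Lemma isomorphic_canonicalP p q r s (c : canonical_index K) :
  isomorphic_structures (@UT_mul K 3) (e13_mul p q r s) (canonical_structure c)
  <-> c = normal_index p q r s.
Proof.
rewrite /normal_index; split=> [|->].
  case: c => [alpha beta gamma|alpha beta|alpha beta];
    case/isomorphic_e13_mulP => -> -> [t t0 [Ep ->]].
  - by rewrite mul1r t0 Ep.
  - have p0 : p != 0.
      by apply: contra_eq_neq Ep => ->; rewrite mul0r oner_neq0.
    by rewrite mul0r eqxx p0.
  move/esym/eqP: Ep; rewrite mulf_eq0 (negPf t0) orbF => /eqP ->.
  by rewrite mul0r eqxx.
case: eqP => [-> | /eqP s0] /=.
  case: eqP => [-> | /eqP p0] /=; apply/isomorphic_e13_mulP; split=> //.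
    by exists 1; rewrite ?oner_neq0 // !mul0r.
  by exists p^-1; rewrite ?invr_neq0 // mulfV // mul0r.
by apply/isomorphic_e13_mulP; split=> //; exists s; rewrite ?mul1r.
Qed.

End Interchangeable.

Theorem proposition4p23 (K : fieldType) :
  (forall c : canonical_index K,
     interchangeable_structure (@UT_mul K 3) (canonical_structure c)) /\
  (forall star : {bilinear UT K 3 -> UT K 3 -> UT K 3},
     interchangeable_structure (@UT_mul K 3) star ->
     (exists! c : canonical_index K,
        isomorphic_structures (@UT_mul K 3) star (canonical_structure c)) /\
     totally_compatible (@UT_mul K 3) star).
Proof.
split=> [[alpha beta gamma|alpha beta|alpha beta] | star star_interch];
  try exact: e13_mul_interchangeable.
have [p [q [r [s starE]]]] := interchangeable_e13_mul _ _ star_interch.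
have isoE c : isomorphic_structures (@UT_mul K 3) star (canonical_structure c)
    <-> c = normal_index _ p q r s.
  rewrite -isomorphic_canonicalP.
  by split=> -[phi [phi_aut phi_iso]]; exists phi; split=> // x y;
    rewrite -phi_iso starE.
split.
  by exists (normal_index _ p q r s); split=> [|c /isoE //]; apply/isoE.
split=> [|x y z]; first by case: star_interch.
rewrite !starE.
have [[_ _ E1 E2] [E3 E4]] := e13_mul_triple0 _ p q r s x y z.
split; first exact: etrans E1 (esym E3).
  exact: etrans E3 (esym E4).
exact: etrans E4 (esym E2).
Qed.
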